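(* Let $p$ be a prime and let $a$ be an integer with $(a,p)=1$. If $a$ is a quadratic residue modulo $p$, then the set $$\mathcal{M}:=\{a,a^2,\ldots,a^{p-1}\}$$ contains at least two non-ramifiers modulo $p$.
   Context: For a positive integer $k$, the residue of $n$ modulo $k$ means the least nonnegative residue, i.e. the integer $b\in\{0,1,\dots,k-1\}$ with $n\equiv b\pmod k$. Let $n\geq 2$ be an integer, let $m$ be a modulus, and let $b_1$ be the residue of $n$ modulo $m$. The integer $n$ is said to ramify modulo $m$ (to be a ramifier modulo $m$) if there exists a positive integer $r<m$ such that the residue $b_2$ of $n$ modulo $r$ satisfies $b_1+b_2=m$. A non-ramifier modulo $m$ is an integer that is not a ramifier modulo $m$.
   Formalization: The formal theorem assumes that p is not 2 and that a is not 1: if p = 2 then the set M is just {a}, and if a = 1 then M is just {1}, so in these cases M cannot contain two distinct non-ramifiers. *)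

(* Defs.v *)
From mathcomp Require Import all_boot all_order all_algebra.

Set Implicit Arguments.
Unset Strict Implicit.
Unset Printing Implicit Defensive.

Import GRing.Theory Num.Theory.

Local Open Scope ring_scope.

(* For k > 0, (n %% k)%Z is the least nonnegative residue, also for n < 0. *)
Definition residue (n : int) (k : nat) : int := (n %% k%:Z)%Z.

Definition ramifier (m : nat) (n : int) : Prop :=
  2 <= n /\
  exists r : nat, [/\ (0 < r)%N, (r < m)%N & residue n m + residue n r = m%:Z].

(* Ramification is a property of integers n >= 2 only, so an integer n < 2 is
   never a ramifier and counts as a non-ramifier. *)
Definition non_ramifier (m : nat) (n : int) : Prop := ~ ramifier m n.

(* Coprimality to p is not part of this predicate. *)
Definition quadratic_residue (p : nat) (a : int) : Prop :=
  exists x : int, (x ^+ 2 = a %[mod p%:Z])%Z.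

(* The list a, a^2, ..., a^(p-1), possibly with repetitions; only membership
   in it is meaningful. *)
Definition powers (a : int) (p : nat) : seq int :=
  [seq a ^+ i | i <- iota 1 p.-1].

(* Main.v *)
Require Import Defs.
From mathcomp Require Import all_boot all_order all_algebra.
From mathcomp Require Import cyclic zify.

Import GRing.Theory Num.Theory.

Local Open Scope ring_scope.

(** An integer n congruent to 1 modulo p could only ramify if its residue
    modulo some r < p were p - 1, but that residue is smaller than r.  So every
    power of a congruent to 1 is a non-ramifier ([non_ramifier_mod1]).  By
    Fermat a^(p-1) is one, and since a is a square modulo p, so is a^((p-1)/2)
    ([quadratic_residue_exp_half]).  These are different integers as soon as
    |a| > 1.  As a is coprime to p and is not 1, the only other case is a = -1,
    whose powers -1 and 1 are both less than 2 and hence do not ramify. *)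

Lemma non_ramifier_lt2 (m : nat) (n : int) : n < 2 -> non_ramifier m n.
Proof. by move=> n_lt2 [n_ge2 _]; lia. Qed.

Lemma non_ramifier_mod1 (m : nat) (n : int) :
  (n = 1 %[mod m%:Z])%Z -> non_ramifier m n.
Proof.
move=> n_mod1 [_ [r [r_gt0 r_ltm]]]; rewrite /residue n_mod1.
rewrite [(1 %% _)%Z]modz_small; last by lia.
have : (n %% r%:Z)%Z < r%:Z by apply: ltz_pmod; lia.
lia.
Qed.

(** The easy direction of Euler's criterion: if x^2 = a then
    a^((p-1)/2) = x^(p-1), which is 1 by Fermat.  Replacing x by its absolute
    value leaves the square unchanged and gives access to Euler's theorem on
    natural numbers. *)
Lemma quadratic_residue_exp_half (p : nat) (a : int) :
    prime p -> p <> 2%N -> coprimez a p%:Z -> quadratic_residue p a ->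
  (a ^+ (p.-1)./2 = 1 %[mod p%:Z])%Z.
Proof.
move=> p_prime p_odd a_coprime [x x2_a].
have p1_even : ((p.-1)./2.*2 = p.-1)%N.
  case: (even_prime p_prime) => // odd_p.
  by apply: even_halfK; case: p odd_p {p_prime p_odd a_coprime x2_a}.
have x_coprime : coprime `|x|%N p.
  have : coprimez (x ^+ 2) p%:Z.
    by rewrite /coprimez -gcdz_modl x2_a gcdz_modl.
  by rewrite coprimezE abszX coprime_pexpl.
rewrite -modzXm -x2_a modzXm -[x ^+ 2]real_normK ?num_real //.
rewrite -exprM mul2n p1_even -abszE -rmorphXn /=.
have := Euler_exp_totient x_coprime.
rewrite totient_prime // => fermat.
by rewrite !modz_nat fermat.
Qed.

Lemma mem_powers (a : int) (p i : nat) :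
  (0 < i < p)%N -> a ^+ i \in powers a p.
Proof. by move=> i_range; apply: map_f; rewrite mem_iota; lia. Qed.

Theorem theorem3p4 (p : nat) (a : int) (p_prime : prime p) (p_odd : p <> 2%N)
    (a_neq1 : a <> 1) (a_coprime : coprimez a p%:Z)
    (a_qr : quadratic_residue p a) :
  exists x y : int,
    [/\ x \in powers a p, y \in powers a p, x <> y,
        non_ramifier p x & non_ramifier p y].
Proof.
have p_gt2 : (2 < p)%N by have := prime_gt1 p_prime; lia.
have half_mod1 := quadratic_residue_exp_half _ _ p_prime p_odd a_coprime a_qr.
have a_neq0 : a != 0.
  by apply: contraTneq a_coprime => ->; rewrite coprimezE /= /coprime gcd0n; lia.
have [a_gt1 | a_le1] := ltnP 1 `|a|%N.
  exists (a ^+ (p.-1)./2), (a ^+ p.-1); split.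
  - by apply: mem_powers; lia.
  - by apply: mem_powers; lia.
  - move/(congr1 absz); rewrite !abszX => /eqP; rewrite eqn_exp2l //; lia.
  - exact: non_ramifier_mod1.
  - apply: non_ramifier_mod1.
    have -> : p.-1 = ((p.-1)./2 * 2)%N.
      by have [//|] := even_prime p_prime; lia.
    by rewrite exprM -modzXm half_mod1 modzXm expr1n.
have -> : a = -1 by lia.
exists ((-1) ^+ 1), ((-1) ^+ 2); split.
- by apply: mem_powers; lia.
- by apply: mem_powers; lia.
- by [].
- exact: non_ramifier_lt2.
- exact: non_ramifier_lt2.
Qed.
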